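(* For each quotient-component $\underline C$ of $\underline\Gamma$, the probability distribution $\pi_{\underline C}(\underline u)=\mathrm{LP}(\underline u)\mathrm{RP}(\underline u)/K_{\underline C}$ ($\underline u\in\underline C$), with $K_{\underline C}=|\mathcal P_{\mathrm R\to\mathrm L}(\underline C)|\cdot(\mathbb E_{\underline C}[\mathrm{len}(\eta)]+1)$, satisfies the reversibility (detailed balance) condition for the induced root-to-leaf path random walk on $\underline\Gamma$; consequently it is the stationary distribution associated with $\underline C$.
   Context: A double cover of a graded signed graph is $\Gamma=(X,E,[\cdot:\cdot],\dim,-)$: $X$ finite nonempty, $E$ directed edges ($u\subset v$), signature $[v:u]\in\{\pm1\}$, $\dim:X\to\mathbb Z$, $-$ a fixed-point-free involution, with $u\subset v\Rightarrow\dim u<\dim v$, $-u\subset v$, $u\subset-v$, $[-v:u]=[v:-u]=-[v:u]$, and $\dim(-u)=\dim u$. Quotient $\underline\Gamma$: nodes $\underline u=\{u,-u\}$, edges $\underline u\subset\underline v$ iff $u\subset v$. Leaf: no $\underline v\supset\underline u$; root: no $\underline t\subset\underline u$. $\mathrm{LP}=1$ on leaves, $\sum_{\underline v\supset\underline u}\mathrm{LP}(\underline v)$ otherwise; $\mathrm{RP}=1$ on roots, $\sum_{\underline t\subset\underline u}\mathrm{RP}(\underline t)$ otherwise. The induced walk on $\underline\Gamma$ has $P(\underline u,\underline u')=\frac12\mathrm{LP}(\underline u')/\mathrm{LP}(\underline u)$ if $\underline u\subset\underline u'$; $\frac12\mathrm{RP}(\underline u')/\mathrm{RP}(\underline u)$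 if $\underline u'\subset\underline u$; $1/2$ if $\underline u=\underline u'$ is exactly one of leaf/root; $1$ if $\underline u=\underline u'$ is both; $0$ otherwise. A quotient-component is a connected component of the undirected graph underlying $\underline\Gamma$. $\mathcal P_{\mathrm R\to\mathrm L}(\underline C)$ is the set of root-to-leaf paths in $\underline C$, i.e. sequences $\underline w_0\subset\dots\subset\underline w_n$ in $\underline C$ from a root to a leaf ($n=\mathrm{len}(\eta)\ge0$), and $\mathbb E_{\underline C}[\mathrm{len}(\eta)]$ is the expected length of a uniformly random such path. *)

(* Defs.v *)
From HB Require Import structures.
From mathcomp Require Import all_boot all_order all_algebra.

Set Implicit Arguments.
Unset Strict Implicit.
Unset Printing Implicit Defensive.

Import Order.TTheory GRing.Theory Num.Theory.
Local Open Scope ring_scope.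

(* [incl u v] is u \subset v and [sign v u] is [v:u].  The signature is total
   as a function, but it is only constrained on edges. *)
Record double_cover := DoubleCover {
  node :> finType;
  incl : rel node;
  sign : node -> node -> int;
  dim : node -> int;
  opp : node -> node;
  node_nonempty : (0 < #|node|)%N;
  signP : forall u v, incl u v -> sign v u = 1 \/ sign v u = -1;
  oppK : involutive opp;
  opp_neq : forall u, opp u != u;
  incl_dim : forall u v, incl u v -> dim u < dim v;
  incl_oppl : forall u v, incl u v -> incl (opp u) v;
  incl_oppr : forall u v, incl u v -> incl u (opp v);
  sign_oppl : forall u v, incl u v -> sign (opp v) u = - sign v u;
  sign_oppr : forall u v, incl u v -> sign v (opp u) = - sign v u;
  dim_opp : forall u, dim (opp u) = dim u
}.

Definition is_qnode (G : double_cover) (A : {set G}) : bool :=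
  [exists u : G, A == [set u; opp u]].

Definition qnode (G : double_cover) : finType :=
  {A : {set G} | is_qnode A}.

Lemma qclass_subproof (G : double_cover) (u : G) : is_qnode [set u; opp u].
Proof. by apply/existsP; exists u. Qed.

Definition qclass (G : double_cover) (u : G) : qnode G :=
  exist _ [set u; opp u] (qclass_subproof u).

Definition qincl (G : double_cover) : rel (qnode G) :=
  fun A B => [exists u in val A, exists v in val B, incl u v].

Definition is_leaf (G : double_cover) (u : qnode G) : bool :=
  [forall v, ~~ qincl u v].

Definition is_root (G : double_cover) (u : qnode G) : bool :=
  [forall t, ~~ qincl t u].

(* Recursion truncated at depth n.  For an acyclic e on T the depth #|T| is
   never exhausted: see LP_rec and RP_rec. *)
Fixpoint count_maxpaths (T : finType) (e : rel T) (n : nat) (u : T) : nat :=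
  if n is m.+1 then
    if [forall v, ~~ e u v] then 1%N
    else (\sum_(v | e u v) count_maxpaths e m v)%N
  else 0%N.

Definition LP (G : double_cover) (u : qnode G) : nat :=
  count_maxpaths (@qincl G) #|qnode G| u.

Definition RP (G : double_cover) (u : qnode G) : nat :=
  count_maxpaths (fun v t => qincl t v) #|qnode G| u.

Definition qwalk (R : realFieldType) (G : double_cover) (u v : qnode G) : R :=
  if qincl u v then 2^-1 * ((LP v)%:R / (LP u)%:R)
  else if qincl v u then 2^-1 * ((RP v)%:R / (RP u)%:R)
  else if u == v then
    if is_leaf u && is_root u then 1
    else if is_leaf u || is_root u then 2^-1
    else 0
  else 0.

Definition qadj (G : double_cover) : rel (qnode G) :=
  fun u v => qincl u v || qincl v u.

Definition is_qcomponent (G : double_cover) (C : {set qnode G}) : Prop :=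
  exists u, C = [set v | connect (@qadj G) u v].

Definition is_rlpath (G : double_cover) (C : {set qnode G})
    (p : seq (qnode G)) : bool :=
  if p is w0 :: s then
    [&& path (@qincl G) w0 s, all [in C] p, is_root w0 & is_leaf (last w0 s)]
  else false.

(* The size bound loses no path: see rlpath_size. *)
Definition rlpaths (G : double_cover) (C : {set qnode G}) :
    {set {bseq #|qnode G| of qnode G}} :=
  [set p : {bseq #|qnode G| of qnode G} | is_rlpath C p].

Definition plen (T : Type) (p : seq T) : nat := (size p).-1.

Definition mean_len (R : realFieldType) (G : double_cover)
    (C : {set qnode G}) : R :=
  (\sum_(p in rlpaths C) (plen p)%:R) / #|rlpaths C|%:R.

Definition Kconst (R : realFieldType) (G : double_cover)
    (C : {set qnode G}) : R :=
  #|rlpaths C|%:R * (mean_len R C + 1).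

(* Extended by 0 to the nodes outside C. *)
Definition pi_C (R : realFieldType) (G : double_cover) (C : {set qnode G})
    (u : qnode G) : R :=
  if u \in C then (LP u)%:R * (RP u)%:R / Kconst R C else 0.

Definition is_distribution (R : realFieldType) (T : finType) (C : {set T})
    (mu : T -> R) : Prop :=
  [/\ forall u, 0 <= mu u, forall u, u \notin C -> mu u = 0
    & \sum_(u in C) mu u = 1].

Definition detailed_balance (R : realFieldType) (T : finType)
    (P : T -> T -> R) (mu : T -> R) : Prop :=
  forall u v, mu u * P u v = mu v * P v u.

Definition stationary (R : realFieldType) (T : finType)
    (P : T -> T -> R) (mu : T -> R) : Prop :=
  forall v, \sum_u mu u * P u v = mu v.

Lemma qincl_qclass (G : double_cover) (u v : G) :
  qincl (qclass u) (qclass v) = incl u v.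
Proof.
have Nl (x y : G) : incl (opp x) y = incl x y.
  by apply/idP/idP => /incl_oppl //; rewrite oppK.
have Nr (x y : G) : incl x (opp y) = incl x y.
  by apply/idP/idP => /incl_oppr //; rewrite oppK.
apply/existsP/idP => [[x /andP[xu /existsP[y /andP[yv]]]]|uv].
  by move: xu yv; rewrite !inE => /orP[]/eqP-> /orP[]/eqP->; rewrite ?Nl ?Nr.
exists u; rewrite !inE eqxx /=; apply/existsP; exists v.
by rewrite !inE eqxx.
Qed.

Lemma qclassP (G : double_cover) (A : qnode G) : exists u, A = qclass u.
Proof.
by case: A => A PA; have /existsP[u /eqP Au] := PA; exists u; apply: val_inj.
Qed.

Definition qdim (G : double_cover) (A : qnode G) : int :=
  odflt 0 (omap (@dim G) [pick u in val A]).

Lemma qincl_dim (G : double_cover) (A B : qnode G) :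
  qincl A B -> qdim A < qdim B.
Proof.
have qdimE (u : G) : qdim (qclass u) = dim u.
  rewrite /qdim; case: pickP => [x|/(_ u)]; last by rewrite !inE eqxx.
  by rewrite !inE => /orP[]/eqP-> //=; rewrite dim_opp.
have [u ->] := qclassP A; have [v ->] := qclassP B.
by rewrite qincl_qclass !qdimE; apply: incl_dim.
Qed.

Lemma count_maxpaths_rec (T : finType) (e : rel T) (d : T -> int) (u : T) :
  (forall x y, e x y -> d x < d y) ->
  count_maxpaths e #|T| u =
    if [forall v, ~~ e u v] then 1%N
    else (\sum_(v | e u v) count_maxpaths e #|T| v)%N.
Proof.
move=> ed; pose m x := #|[set y | d x < d y]|.
have mlt x y : e x y -> (m y < m x)%N.
  move=> /ed xy; apply/proper_card/properP; split.
    by apply/subsetP=> z; rewrite !inE; apply: lt_trans.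
  by exists y; rewrite !inE ?ltxx.
have mT x : (m x < #|T|)%N.
  by rewrite -cardsT; apply/proper_card/properP; split=> //; exists x; rewrite ?inE ?ltxx.
have stab n x : (m x < n)%N -> count_maxpaths e n x = count_maxpaths e n.+1 x.
  elim: n x => [//|n IH] x xn; rewrite [LHS]/= [RHS]/=; case: ifP => // _.
  by apply: eq_bigr => v xv; apply: IH; exact: leq_trans (mlt _ _ xv) _.
rewrite stab ?mT //=; case: ifP => // _.
Qed.

Lemma LP_rec (G : double_cover) (u : qnode G) :
  LP u = if is_leaf u then 1%N else (\sum_(v | qincl u v) LP v)%N.
Proof. exact: count_maxpaths_rec (@qincl_dim G). Qed.

Lemma RP_rec (G : double_cover) (u : qnode G) :
  RP u = if is_root u then 1%N else (\sum_(t | qincl t u) RP t)%N.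
Proof.
apply: (@count_maxpaths_rec _ _ (fun A => - qdim A)) => x y /qincl_dim.
by rewrite ltrN2.
Qed.

Lemma rlpath_size (G : double_cover) (C : {set qnode G}) (p : seq (qnode G)) :
  is_rlpath C p -> (size p <= #|qnode G|)%N.
Proof.
case: p => [//|w s] /andP[pth _]; rewrite -(card_uniqP _) ?max_card //.
have : sorted <%O (map (@qdim G) (w :: s)).
  by apply: homo_path pth => x y; exact: qincl_dim.
by move/lt_sorted_uniq/map_uniq.
Qed.

(* Main.v *)
(** Writing [w u = LP u * RP u], both sides of detailed balance along an edge
    u < v equal [RP u * LP v / 2], and the recursions for LP and RP say that
    the rows of the walk sum to 1, so [w] is stationary.  Its total mass on a
    component is found by double counting: cutting a root-to-leaf path at a
    node u shows that [w u] such paths pass through u, so the mass is the sum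
    over the paths of their numbers of nodes [len + 1].  Uniqueness is the
    Dirichlet form argument: for a stationary [mu], the density [mu / w] has
    zero energy, hence is constant along edges and thus on components. *)

Require Import Defs.
From HB Require Import structures.
From mathcomp Require Import all_boot all_order all_algebra.
From mathcomp Require Import ring lra.

Set Implicit Arguments.
Unset Strict Implicit.
Unset Printing Implicit Defensive.

Import Order.TTheory GRing.Theory Num.Theory.
Local Open Scope ring_scope.

(** * Maximal paths in acyclic relations *)

(** Lists what [count_maxpaths] counts. A path omits its starting node, so a leaf yields just the
    empty sequence. *)
Fixpoint maxpaths (T : finType) (e : rel T) (n : nat) (u : T) : seq (seq T) :=
  if n is m.+1 then
    if [forall v, ~~ e u v] then [:: [::]]
    else [seq v :: p | v <- enum (e u), p <- maxpaths e m v]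
  else [::].

Section AcyclicPaths.
Variables (T : finType) (e : rel T).

Lemma size_maxpaths n u : size (maxpaths e n u) = count_maxpaths e n u.
Proof.
elim: n u => //= n IH u; case: ifP => // _.
rewrite size_allpairs_dep sumnE big_map big_enum /=.
by apply: eq_bigr => v _; apply: IH.
Qed.

Lemma maxpaths_uniq n u : uniq (maxpaths e n u).
Proof.
elim: n u => //= n IH u; case: ifP => // _.
apply: allpairs_uniq_dep => [|v _|]; rewrite ?enum_uniq //.
by move=> [v p] [v' p'] _ _ /= [-> ->].
Qed.

Lemma mem_maxpaths n u p :
  (p \in maxpaths e n u) =
  [&& path e u p, [forall v, ~~ e (last u p) v] & (size p < n)%N].
Proof.
elim: n u p => [|n IH] u p /=; first by rewrite ltn0 !andbF.
case: ifP => [/forallP leaf_u|nleaf].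
  case: p => [|v p] /=; first by rewrite inE eqxx andbT; apply/esym/forallP.
  by rewrite inE (negbTE (leaf_u v)).
case: p => [|v p] /=.
  by rewrite nleaf; apply/negbTE/allpairsPdep => -[x [y []]].
rewrite ltnS -andbA -IH; apply/allpairsPdep/andP => [[x [y []]]|[uv vp]].
  by rewrite mem_enum => ux yx [-> ->].
by exists v, p; rewrite mem_enum.
Qed.

Variable d : T -> int.
Hypothesis e_d : forall x y, e x y -> d x < d y.

Lemma acyclic_path_uniq u p : path e u p -> uniq (u :: p).
Proof.
move=> pth; have : sorted <%O (map d (u :: p)) by apply: homo_path pth.
by move/lt_sorted_uniq/map_uniq.
Qed.

(** A path in an acyclic relation repeats no node, so [u :: p] has at most [#|T|] entries and the
    depth bound excludes nothing. *)
Lemma mem_maxpaths_card u p :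
  (p \in maxpaths e #|T| u) = path e u p && [forall v, ~~ e (last u p) v].
Proof.
rewrite mem_maxpaths; case: (boolP (path e u p)) => //= /acyclic_path_uniq up.
by rewrite (_ : (size p < _)%N) ?andbT // -[(_ < _)%N]/(size (u :: p) <= _)%N
  -(card_uniqP up) max_card.
Qed.

Lemma count_maxpaths_gt0 u : (0 < count_maxpaths e #|T| u)%N.
Proof.
(* Induction on the number of nodes with larger [d], which drops along every edge. *)
have [k] := ubnP #|[set y | d u < d y]|; elim: k u => // k IH u ku.
rewrite (count_maxpaths_rec _ e_d); case: ifP => //.
move=> /negbT; rewrite negb_forall => /existsP[v /negPn uv].
rewrite (bigD1 v) //= addn_gt0 IH //.
move: ku; rewrite ltnS; apply: leq_trans; apply/proper_card/properP; split.
  by apply/subsetP=> z; rewrite !inE; apply/lt_trans/e_d.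
by exists v; rewrite !inE ?ltxx ?e_d.
Qed.

End AcyclicPaths.

(** * Reversible Markov chains *)

Section Reversible.
Variables (R : realFieldType) (T : finType) (P : T -> T -> R).
Hypothesis P_sum1 : forall u, \sum_v P u v = 1.

Lemma detailed_balance_stationary (mu : T -> R) :
  detailed_balance P mu -> stationary P mu.
Proof.
move=> db v; under eq_bigr do rewrite db.
by rewrite -mulr_sumr P_sum1 mulr1.
Qed.

(* Since [mu] is stationary, [f = mu / w] is harmonic, and expanding the
   square in the Dirichlet form gives
   [\sum_(u, v) w u * P u v * (f u - f v)^2 = 0]. *)
Lemma stationary_density_edge (w mu : T -> R) u v :
  (forall x y, 0 <= P x y) -> (forall x, 0 < w x) ->
  detailed_balance P w -> stationary P mu ->
  P u v != 0 -> mu u / w u = mu v / w v.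
Proof.
move=> P_ge0 w_gt0 db st Puv.
pose f x := mu x / w x.
have muE x : mu x = w x * f x by rewrite mulrC divfK // gt_eqF.
have harm x : \sum_y w x * P x y * f y = w x * f x.
  rewrite -muE -[RHS]st; apply: eq_bigr => y _.
  by rewrite muE db mulrAC.
have harm' x : \sum_y w x * P x y = w x by rewrite -mulr_sumr P_sum1 mulr1.
pose E x y := w x * P x y * (f x - f y) ^+ 2.
have E_ge0 x y : 0 <= E x y.
  by rewrite mulr_ge0 ?sqr_ge0 // mulr_ge0 // ltW.
have E0 : \sum_x \sum_y E x y = 0.
  (* By harmonicity the first double sum vanishes for each [x]; exchanging the sums and applying
     detailed balance turns the second into the first. *)
  have -> : \sum_x \sum_y E x y =
      \sum_x \sum_y (w x * P x y * f x ^+ 2 - w x * P x y * f y * f x)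
      + \sum_x \sum_y (w x * P x y * f y ^+ 2 - w x * P x y * f y * f x).
    rewrite -big_split; apply: eq_bigr => x _; rewrite -big_split.
    by apply: eq_bigr => y _; rewrite /E sqrrB /=; ring.
  rewrite [X in _ + X]exchange_big /=.
  have h x : \sum_y (w x * P x y * f x ^+ 2 - w x * P x y * f y * f x) = 0.
    by rewrite sumrB -!mulr_suml harm harm' expr2 mulrA subrr.
  rewrite !big1 ?addr0 // => x _; rewrite -[RHS](h x).
  by apply: eq_bigr => y _; rewrite db; congr (_ - _); rewrite mulrAC.
have Euv : E u v = 0.
  have /eqP := E0; rewrite psumr_eq0 => [|x _]; last exact: sumr_ge0.
  move=> /allP/(_ u (mem_index_enum _)) /=; rewrite psumr_eq0 //.
  by move=> /allP/(_ v (mem_index_enum _)) /eqP.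
move/eqP: Euv; rewrite /E !mulf_eq0 (negbTE Puv) gt_eqF //= orbb subr_eq0.
by move/eqP.
Qed.

End Reversible.

(** * The root-to-leaf walk *)

Section Quotient.
Variable G : double_cover.
Implicit Types (u v : qnode G) (C : {set qnode G}).

Definition rincl : rel (qnode G) := fun v t => qincl t v.

Lemma rincl_dim u v : rincl u v -> - qdim u < - qdim v.
Proof. by rewrite ltrN2; apply: qincl_dim. Qed.

Lemma LP_gt0 u : (0 < LP u)%N.
Proof. exact: count_maxpaths_gt0 (@qincl_dim G) u. Qed.

Lemma RP_gt0 u : (0 < RP u)%N.
Proof. exact: (count_maxpaths_gt0 (d := fun x => - qdim x) rincl_dim). Qed.

Lemma qincl_asym u v : qincl u v -> qincl v u = false.
Proof.
move=> /qincl_dim uv; apply/negbTE/negP => /qincl_dim /(lt_trans uv).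
by rewrite ltxx.
Qed.

Lemma qinclxx u : qincl u u = false.
Proof. by apply/negbTE/negP => /qincl_dim; rewrite ltxx. Qed.

(** * Components and the root-to-leaf paths in them *)

Lemma qcomponent_closed C u v :
  is_qcomponent C -> qadj u v -> (u \in C) = (v \in C).
Proof.
move=> [x ->] uv; rewrite !inE.
have vu : qadj v u by rewrite /qadj orbC.
by apply/idP/idP => /connect_trans; apply; apply: connect1.
Qed.

Lemma qcomponent_path C u p : is_qcomponent C -> u \in C ->
  path (@qadj G) u p -> all [in C] p.
Proof.
move=> hC; elim: p u => //= v p IH u uC /andP[uv vp].
have vC : v \in C by rewrite -(qcomponent_closed hC uv).
by rewrite vC; apply: IH vp.
Qed.

(** Both halves start at [u]: [q] descends to a root and is then reversed, [p] ascends to a leaf. *)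
Definition paths_through u : seq (seq (qnode G)) :=
  [seq rev q ++ u :: p | q <- maxpaths rincl #|qnode G| u,
                         p <- maxpaths (@qincl G) #|qnode G| u].

(** [is_rlpath] inspects the head of the sequence, so the root [last u q] has to be exposed. *)
Let rev_catE u q p :
  rev q ++ u :: p = last u q :: (rev (belast u q) ++ p).
Proof. by rewrite -cat_rcons -rev_cons lastI rev_rcons. Qed.

Let last_rev_belast u q : last (last u q) (rev (belast u q)) = u.
Proof. by case: q => //= v q; rewrite rev_cons last_rcons. Qed.

(** Both halves are undirected paths from [u], so they stay in its component. Conversely, a path
    containing [u] is cut there. *)
Lemma mem_paths_through C u x : is_qcomponent C -> u \in C ->
  (x \in paths_through u) = is_rlpath C x && (u \in x).
Proof.
move=> hC uC; apply/allpairsP/andP.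
  move=> [[q p] /= []]; rewrite (mem_maxpaths_card rincl_dim).
  rewrite (mem_maxpaths_card (@qincl_dim G)) => /andP[uq rq] /andP[up lp] ->.
  split; last by rewrite mem_cat mem_head orbT.
  have CE : all [in C] (rev q ++ u :: p).
    rewrite all_cat all_rev /= uC.
    rewrite (qcomponent_path hC uC (sub_path _ uq)) => [|a b ab]; last first.
      by rewrite /qadj orbC [qincl b a]ab.
    by apply: qcomponent_path hC uC (sub_path _ up) => a b ab; rewrite /qadj ab.
  move: CE; rewrite rev_catE /is_rlpath => ->.
  by rewrite cat_path last_cat rev_path last_rev_belast uq up /=; apply/andP.
case: x => [|w s] [] //= /and4P[pth _ rw lw] us.
case/splitPl: us pth lw => p1 p2 lu; rewrite cat_path last_cat lu.
(* The initial part [w :: p1] ends in [u]; dropping [u] and reversing gives the descending half. *)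
move=> /andP[wp1 up2] lw; exists (rev (belast w p1), p2) => /=.
rewrite (mem_maxpaths_card rincl_dim) (mem_maxpaths_card (@qincl_dim G)).
rewrite up2 -[X in path rincl X _]lu -[X in last X (rev _)]lu.
rewrite last_rev_belast rev_path; split; last first.
- by rewrite revK -cat_rcons -lu -lastI.
- by [].
- by apply/andP.
Qed.

(** Acyclicity keeps [u] out of [q], so the index of [u] in the concatenation is the length of [q],
    and the cut can be recovered. *)
Lemma paths_through_uniq u : uniq (paths_through u).
Proof.
apply: allpairs_uniq; rewrite ?maxpaths_uniq // => -[q p] [q' p'].
have notin r : r \in maxpaths rincl #|qnode G| u -> u \notin rev r.
  rewrite (mem_maxpaths_card rincl_dim).
  move=> /andP[/(acyclic_path_uniq rincl_dim)].
  by rewrite mem_rev /= => /andP[].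
move=> /allpairsP[[a b] /= [/notin ua _ [-> ->]]].
move=> /allpairsP[[a' b'] /= [/notin ua' _ [-> ->]]] E.
have : index u (rev a ++ u :: b) = index u (rev a' ++ u :: b') by rewrite E.
rewrite !index_cat (negbTE ua) (negbTE ua') /= eqxx !addn0 => sz.
move/eqP: E; rewrite eqseq_cat // eqseq_cons => /and3P[/eqP/(can_inj revK)-> _].
by move/eqP->.
Qed.

Lemma card_rlpaths_through C u : is_qcomponent C -> u \in C ->
  #|[set p in rlpaths C | u \in val p]| = (LP u * RP u)%N.
Proof.
move=> hC uC; rewrite mulnC /LP /RP -!size_maxpaths.
rewrite -(size_allpairs (fun q p => rev q ++ u :: p)) cardE -(size_map val).
apply/perm_size/uniq_perm.
- by rewrite map_inj_uniq ?enum_uniq //; apply: val_inj.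
- exact: paths_through_uniq.
move=> x; rewrite (mem_paths_through _ hC uC); apply/mapP/andP.
  by move=> [p]; rewrite mem_enum !inE => /andP[rp up] ->.
move=> [rx ux]; exists (Bseq (rlpath_size rx)) => //.
by rewrite mem_enum !inE /= rx.
Qed.

(** Double counting of pairs of a path and a node on it; since no path repeats a node, its size is
    its number of distinct nodes. *)
Lemma sum_size_rlpaths C : is_qcomponent C ->
  (\sum_(p in rlpaths C) size p = \sum_(u in C) LP u * RP u)%N.
Proof.
move=> hC.
have sz (p : {bseq #|qnode G| of qnode G}) : p \in rlpaths C ->
    size p = (\sum_(u in C | u \in val p) 1)%N.
  rewrite inE; case: p => -[|w s] //= _ /and4P[pth sC _ _].
  have /card_uniqP /= <- := acyclic_path_uniq (@qincl_dim G) pth.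
  rewrite -sum1_card; apply: eq_bigl => u; rewrite andb_idl //.
  by move: u; apply/allP.
rewrite (eq_bigr _ sz) (exchange_big_dep [in C]) /= => [|p u _ /andP[]//].
apply: eq_bigr => u uC; rewrite -(card_rlpaths_through hC uC) -sum1_card.
by apply: eq_bigl => p; rewrite !inE uC.
Qed.

(** * The normalising constant *)

Variable R : realFieldType.

Let LP0 u : (LP u)%:R != 0 :> R.
Proof. by rewrite pnatr_eq0 -lt0n LP_gt0. Qed.

Let RP0 u : (RP u)%:R != 0 :> R.
Proof. by rewrite pnatr_eq0 -lt0n RP_gt0. Qed.

Let w u : R := (LP u)%:R * (RP u)%:R.

Let w_gt0 u : 0 < w u.
Proof. by rewrite mulr_gt0 // ltr0n ?LP_gt0 ?RP_gt0. Qed.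

Lemma Kconst_sum C : is_qcomponent C ->
  Kconst R C = \sum_(u in C) (LP u)%:R * (RP u)%:R.
Proof.
move=> hC; under eq_bigr do rewrite -natrM.
rewrite -natr_sum -sum_size_rlpaths // natr_sum /Kconst /mean_len mulrDr mulr1.
(* The mean divides by the number of paths; if there were none, both sides would be 0. *)
have [/cards0_eq->|card_neq0] := eqVneq #|rlpaths C| 0%N.
  by rewrite !big_set0 cards0 mul0r addr0.
rewrite mulrC divfK ?pnatr_eq0 // -sum1_card natr_sum -big_split /=.
apply: eq_bigr => p; rewrite inE /plen => rp.
(* The empty sequence is not a root-to-leaf path, so adding 1 undoes the predecessor in [plen]. *)
by rewrite -natrD addn1 prednK //; case: (val p) rp.
Qed.

(** Positivity is read off the sum form: [C] is nonempty and every term is positive. *)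
Lemma Kconst_gt0 C : is_qcomponent C -> 0 < Kconst R C.
Proof.
move=> hC; rewrite Kconst_sum //; have [u CE] := hC.
have uC : u \in C by rewrite CE inE connect0.
rewrite (bigD1 u) //= ltr_pwDl ?w_gt0 ?sumr_ge0 // => v _.
exact/ltW/w_gt0.
Qed.

(** * Transition probabilities and stationarity *)

Lemma qwalk_ge0 u v : 0 <= qwalk R u v.
Proof.
rewrite /qwalk; do ![case: ifP => _]; rewrite ?ler01 ?invr_ge0 ?ler0n //.
  by rewrite mulr_ge0 ?invr_ge0 ?divr_ge0 ?ler0n.
by rewrite mulr_ge0 ?invr_ge0 ?divr_ge0 ?ler0n.
Qed.

Lemma qwalk_neq0 u v : qadj u v -> qwalk R u v != 0.
Proof.
rewrite /qadj /qwalk => /orP[uv|vu].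
  by rewrite uv !mulf_neq0 ?invr_neq0 // pnatr_eq0.
by rewrite vu (qincl_asym vu) !mulf_neq0 ?invr_neq0 // pnatr_eq0.
Qed.

Lemma sum_LP_div u :
  \sum_(v | qincl u v) ((LP v)%:R / (LP u)%:R) = (~~ is_leaf u)%:R :> R.
Proof.
case: (boolP (is_leaf u)) => [/forallP lu|nl].
  by rewrite big1 // => v uv; have := lu v; rewrite uv.
rewrite -mulr_suml -natr_sum [X in _ / X%:R]LP_rec (negbTE nl) divff //.
by have := LP_gt0 u; rewrite LP_rec (negbTE nl) pnatr_eq0 -lt0n.
Qed.

Lemma sum_RP_div u :
  \sum_(t | qincl t u) ((RP t)%:R / (RP u)%:R) = (~~ is_root u)%:R :> R.
Proof.
case: (boolP (is_root u)) => [/forallP lu|nl].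
  by rewrite big1 // => v uv; have := lu v; rewrite uv.
rewrite -mulr_suml -natr_sum [X in _ / X%:R]RP_rec (negbTE nl) divff //.
by have := RP_gt0 u; rewrite RP_rec (negbTE nl) pnatr_eq0 -lt0n.
Qed.

(** Upward and downward moves carry mass 1/2 each, except at a leaf or a root, where the missing
    halves go to the loop at [u]. *)
Lemma qwalk_sum1 u : \sum_v qwalk R u v = 1.
Proof.
rewrite (bigID (qincl u)) /=.
under eq_bigr => v uv do rewrite /qwalk uv.
rewrite -mulr_sumr sum_LP_div (bigID (fun v => qincl v u)) /=.
have -> : \sum_(v | ~~ qincl u v && qincl v u) qwalk R u v
        = 2^-1 * (~~ is_root u)%:R.
  rewrite -sum_RP_div mulr_sumr; apply: eq_big => v.
    by case: (boolP (qincl v u)) => [/qincl_asym->|]; rewrite ?andbF.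
  by rewrite /qwalk => /andP[/negbTE-> ->].
rewrite (bigD1 u) ?qinclxx //= big1 => [|v /andP[/andP[uv vu] neq]]; last first.
  by rewrite /qwalk (negbTE uv) (negbTE vu) eq_sym (negbTE neq).
rewrite /qwalk qinclxx eqxx; case: (is_leaf u); case: (is_root u) => /=; lra.
Qed.

Lemma LP_RP_detailed_balance :
  detailed_balance (@qwalk R G) (fun u => (LP u)%:R * (RP u)%:R).
Proof.
move=> u v; rewrite /qwalk.
case: (boolP (qincl u v)) => [uv|_].
  by rewrite (qincl_asym uv); field; rewrite LP0 RP0.
case: (boolP (qincl v u)) => [vu|_]; first by field; rewrite LP0 RP0.
by rewrite eq_sym; case: eqP => [->//|_]; rewrite !mulr0.
Qed.

Lemma qwalk_out C u v : is_qcomponent C -> u \in C -> v \notin C ->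
  qwalk R u v = 0.
Proof.
move=> hC uC vC; have uv : ~~ qadj u v.
  by apply: contra vC => /(qcomponent_closed hC)<-.
have neq : (u == v) = false by apply/eqP => uvE; rewrite -uvE uC in vC.
move: uv; rewrite negb_or /qwalk => /andP[/negbTE-> /negbTE->].
by rewrite neq.
Qed.

Lemma pi_C_detailed_balance C : is_qcomponent C ->
  detailed_balance (@qwalk R G) (pi_C R C).
Proof.
move=> hC u v; rewrite /pi_C.
case: (boolP (u \in C)) => uC; case: (boolP (v \in C)) => vC.
- by rewrite mulrAC LP_RP_detailed_balance mulrAC.
- by have -> := qwalk_out hC uC vC; rewrite mulr0 mul0r.
- by have -> := qwalk_out hC vC uC; rewrite mulr0 mul0r.
- by rewrite !mul0r.
Qed.

Lemma pi_C_distribution C : is_qcomponent C -> is_distribution C (pi_C R C).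
Proof.
move=> hC; split=> [u|u uC|].
- rewrite /pi_C; case: ifP => // _.
  by apply: divr_ge0; [exact/ltW/w_gt0|exact/ltW/Kconst_gt0].
- by rewrite /pi_C (negbTE uC).
under eq_bigr => u uC do rewrite /pi_C uC.
by rewrite -mulr_suml -Kconst_sum // divff ?gt_eqF ?Kconst_gt0.
Qed.

(** The density [mu / w] agrees across every edge, so it keeps its value along a path from the base
    point [x] of the component. *)
Lemma stationary_density_qcomponent C (mu : qnode G -> R) :
  is_qcomponent C -> stationary (@qwalk R G) mu ->
  exists a, forall u, u \in C -> mu u = a * ((LP u)%:R * (RP u)%:R).
Proof.
move=> [x ->] st; exists (mu x / w x) => u; rewrite inE => /connectP[p pth ->].
elim: p x pth => [|y p IH] x /= => [_|/andP[xy yp]].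
  by rewrite divfK // gt_eqF ?w_gt0.
rewrite (@stationary_density_edge _ _ _ qwalk_sum1 w mu x y) ?IH //.
- exact: qwalk_ge0.
- exact: LP_RP_detailed_balance.
- exact: qwalk_neq0.
Qed.

End Quotient.

Theorem theorem1p36 (R : realFieldType) (G : double_cover)
    (C : {set qnode G}) (hC : is_qcomponent C) :
  [/\ is_distribution C (pi_C R C),
      detailed_balance (@qwalk R G) (pi_C R C),
      stationary (@qwalk R G) (pi_C R C)
    & forall mu : qnode G -> R,
        is_distribution C mu -> stationary (@qwalk R G) mu ->
        forall u, mu u = pi_C R C u].
Proof.
have piD := pi_C_distribution R hC; have piB := pi_C_detailed_balance R hC.
split=> //; first by apply: detailed_balance_stationary piB; apply: qwalk_sum1.
move=> mu [_ mu0 mu1] st u; rewrite /pi_C.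
case: (boolP (u \in C)) => [uC|/mu0//].
have [a aE] := stationary_density_qcomponent hC st.
(* Total mass 1 forces [a] to be the inverse of [Kconst R C]. *)
move: mu1; rewrite (eq_bigr _ aE) -mulr_sumr -Kconst_sum // => aK.
rewrite aE // mulrC; congr (_ * _).
have K0 := lt0r_neq0 (Kconst_gt0 R hC).
by apply: (mulIf K0); rewrite aK mulVf.
Qed.
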